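(* There are exactly $5$ lattices of $\chi$-logics, for $\chi$ a univariate formula: $$\mathbf{IL}^{\bot},\qquad \mathbf{IL}^{p}=\mathbf{IL},\qquad \mathbf{IL}^{\neg p}=\mathbf{IL}^{\neg\neg p},\qquad \mathbf{IL}^{p\lor\neg p},\qquad \mathbf{IL}^{\top}.$$ That is: $L^p=L$ and $L^{\neg p}=L^{\neg\neg p}$ for every intermediate logic $L$; the lattices $\mathbf{IL}^{\bot},\mathbf{IL}^{p},\mathbf{IL}^{\neg p},\mathbf{IL}^{p\lor\neg p},\mathbf{IL}^{\top}$ are pairwise distinct; and for every univariate formula $\chi$ the lattice $\mathbf{IL}^\chi$ is equal to one of these five. Here $\mathbf{IL}^\chi$ and $\mathbf{IL}^\theta$ are called equal if $L^\chi=L^\theta$ for every intermediate logic $L$, and distinct otherwise.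
   Context: Formulas are built from an infinite set $\mathrm{AP}$ of atomic propositions and $\bot$ using $\land,\lor,\to$; $\neg\phi:=\phi\to\bot$, $\top:=\bot\to\bot$, and $\phi\leftrightarrow\psi:=(\phi\to\psi)\land(\psi\to\phi)$. $\mathtt{IPC}$ and $\mathtt{CPC}$ are the sets of theorems of intuitionistic and classical propositional logic. An intermediate logic is a set of formulas $L$ with $\mathtt{IPC}\subseteq L\subseteq\mathtt{CPC}$ closed under modus ponens and uniform substitution; $\mathbf{IL}$ is the lattice of intermediate logics. A univariate formula $\chi(p)$ is a formula in which no atomic proposition other than $p$ occurs (so $\bot$ and $\top$ are included). Put $\chi^2(q):=\chi(\chi(q))$. For an intermediate logic $L$, its $\chi$-variant $L^\chi$ is the smallest set of formulas such that (i) $\mathtt{IPC}\subseteq L^\chi$; (ii) $\phi[\sigma]\in L^\chi$ for all $\phi\in L$ and all substitutions $\sigma$; (iii) $\chi^2(q)\leftrightarrow q\in L^\chi$ for every atomic proposition $q$; (iv) $L^\chi$ is closed under modus ponens. $\mathbf{IL}^\chi$ denotes the lattice (under inclusion) of $\chi$-logics, i.e. of the $\chi$-variants of intermediate logics. *)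

(* Defs.v *)
From mathcomp Require Import all_boot.
From mathcomp Require Import classical_sets cardinality.

Set Implicit Arguments.
Unset Strict Implicit.
Unset Printing Implicit Defensive.

Local Open Scope classical_set_scope.

Inductive formula (AP : Type) : Type :=
| Atom (x : AP)
| Bot
| And (phi psi : formula AP)
| Or (phi psi : formula AP)
| Imp (phi psi : formula AP).

Arguments Bot {AP}.

Declare Scope formula_scope.
Delimit Scope formula_scope with F.
Bind Scope formula_scope with formula.

Notation "⊥" := Bot (at level 0) : formula_scope.
Infix "⋀" := And (at level 41, right associativity) : formula_scope.
Infix "⋁" := Or (at level 42, right associativity) : formula_scope.
Infix "⟶" := Imp (at level 43, right associativity) : formula_scope.
Notation "∼ phi" := (phi ⟶ ⊥)%F
  (at level 40, phi at level 40, format "∼ phi") : formula_scope.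
Notation "⊤" := (⊥ ⟶ ⊥)%F (at level 0) : formula_scope.
Notation "phi ⟷ psi" := ((phi ⟶ psi) ⋀ (psi ⟶ phi))%F
  (at level 44, no associativity) : formula_scope.

Section Defs.
Variable AP : Type.
Local Notation form := (formula AP).
Implicit Types (p q : AP) (phi psi rho chi theta : form) (L : set form)
  (sigma : AP -> form).

Fixpoint subst sigma phi : form :=
  match phi with
  | Atom x => sigma x
  | Bot => ⊥
  | And a b => subst sigma a ⋀ subst sigma b
  | Or a b => subst sigma a ⋁ subst sigma b
  | Imp a b => subst sigma a ⟶ subst sigma b
  end.

Fixpoint atoms phi : set AP :=
  match phi with
  | Atom x => [set x]
  | Bot => set0
  | And a b | Or a b | Imp a b => atoms a `|` atoms b
  end.

Definition univariate chi : Prop := exists p, atoms chi `<=` [set p].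

(* chi(psi), meaningful for univariate chi only: its one variable, whichever
   it is, is replaced by psi, so the variable need not be named. *)
Definition apply chi psi : form := subst (fun=> psi) chi.

Definition closed_mp L : Prop :=
  forall phi psi, L (phi ⟶ psi)%F -> L phi -> L psi.

Definition closed_subst L : Prop :=
  forall sigma phi, L phi -> L (subst sigma phi).

Inductive ipc_axiom : set form :=
| ax_K phi psi : ipc_axiom (phi ⟶ psi ⟶ phi)%F
| ax_S phi psi rho :
    ipc_axiom ((phi ⟶ psi ⟶ rho) ⟶ (phi ⟶ psi) ⟶ phi ⟶ rho)%F
| ax_and_l phi psi : ipc_axiom (phi ⋀ psi ⟶ phi)%F
| ax_and_r phi psi : ipc_axiom (phi ⋀ psi ⟶ psi)%F
| ax_and_i phi psi : ipc_axiom (phi ⟶ psi ⟶ phi ⋀ psi)%F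
| ax_or_l phi psi : ipc_axiom (phi ⟶ phi ⋁ psi)%F
| ax_or_r phi psi : ipc_axiom (psi ⟶ phi ⋁ psi)%F
| ax_or_e phi psi rho :
    ipc_axiom ((phi ⟶ rho) ⟶ (psi ⟶ rho) ⟶ phi ⋁ psi ⟶ rho)%F
| ax_bot phi : ipc_axiom (⊥ ⟶ phi)%F.

Inductive theorems (Ax : set form) : set form :=
| th_ax phi : Ax phi -> theorems Ax phi
| th_mp phi psi :
    theorems Ax (phi ⟶ psi)%F -> theorems Ax phi -> theorems Ax psi.

Definition IPC : set form := theorems ipc_axiom.

Definition CPC : set form :=
  theorems (ipc_axiom `|` [set (phi ⋁ ∼phi)%F | phi in [set: form]]).

Definition intermediate L : Prop :=
  [/\ IPC `<=` L, L `<=` CPC, closed_mp L & closed_subst L].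

Inductive variant chi L : set form :=
| var_ipc phi : IPC phi -> variant chi L phi
| var_subst sigma phi : L phi -> variant chi L (subst sigma phi)
| var_fix q :
    variant chi L (apply chi (apply chi (Atom q)) ⟷ Atom q)%F
| var_mp phi psi : variant chi L (phi ⟶ psi)%F ->
    variant chi L phi -> variant chi L psi.

(* Equality of the lattices IL^chi and IL^theta is equality of their
   indexings by IL, not of their underlying sets of chi-logics. *)
Definition same_lattice chi theta : Prop :=
  forall L, intermediate L -> variant chi L = variant theta L.

End Defs.

(* Main.v *)
Require Import Defs.
From mathcomp Require Import all_boot.
From mathcomp Require Import classical_sets cardinality.

(** Only [fixpoint chi q], i.e. [chi(chi(q)) <-> q], matters for the variant.
    Under [~psi] every [chi(psi)] is equivalent to ⊥ or ⊤, and under [~~psi] to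
    ⊥, [psi] or ⊤, because these formulas are then closed under the connectives.
    Which of them occurs is read off from the value of [chi] in the three-element
    Heyting chain, at the bottom and at the middle element.  Applied to [psi = q]
    and to [psi = chi(q)], this determines [fixpoint chi q] up to equivalence;
    the six possible pairs of values leave the five formulas [~q], ⊤, [~~q -> q],
    [~~q] and [q].  Their sets of solutions in the three-element chain differ. *)

Set Implicit Arguments.
Unset Strict Implicit.
Unset Printing Implicit Defensive.

Local Open Scope classical_set_scope.
Local Open Scope formula_scope.

(** * Natural deduction in sets closed under modus ponens *)

Section Theories.
Variable AP : Type.
Implicit Types (a b c phi psi chi theta : formula AP) (T L : set (formula AP)).

Definition theory T : Prop := IPC (AP := AP) `<=` T /\ closed_mp T.

Lemma theory_ax T a : theory T -> ipc_axiom a -> T a.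
Proof. by move=> [ipcT _] /th_ax; apply: ipcT. Qed.

(** The formulas implied by [a] over [T] form a theory, by the axioms K and S, and it contains [T]
    and [a]. *)
Lemma theory_imp_intro T a b : theory T ->
  (forall T', theory T' -> T `<=` T' -> T' a -> T' b) -> T (a ⟶ b).
Proof.
move=> thT; have [ipcT mpT] := thT.
have K x : T x -> T (a ⟶ x) by apply: (mpT); exact: theory_ax (ax_K _ _).
move/(_ [set x | T (a ⟶ x)]); apply=> [|x /K //|].
- split=> [x /ipcT /K //|x y hxy]; apply: (mpT); apply: (mpT) hxy.
  exact: theory_ax (ax_S _ _ _).
- apply: (mpT) (theory_ax thT (ax_K a a)).
  apply: (mpT) (theory_ax thT (ax_K a (a ⟶ a))).
  exact: theory_ax (ax_S _ _ _).
Qed.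

Lemma theory_and_intro T a b : theory T -> T a -> T b -> T (a ⋀ b).
Proof.
move=> thT ha; apply: thT.2; apply: thT.2 ha; exact: theory_ax (ax_and_i _ _).
Qed.

Lemma theory_and_elim T a b : theory T -> T (a ⋀ b) -> T a /\ T b.
Proof.
move=> thT hab; split; apply: thT.2 hab; apply: theory_ax => //.
- exact: ax_and_l.
- exact: ax_and_r.
Qed.

Lemma theory_or_introl T a b : theory T -> T a -> T (a ⋁ b).
Proof. by move=> thT; apply: thT.2; exact: theory_ax (ax_or_l _ _). Qed.

Lemma theory_or_intror T a b : theory T -> T b -> T (a ⋁ b).
Proof. by move=> thT; apply: thT.2; exact: theory_ax (ax_or_r _ _). Qed.

Lemma theory_or_elim T a b c : theory T -> T (a ⋁ b) ->
  (forall T', theory T' -> T `<=` T' -> T' a -> T' c) ->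
  (forall T', theory T' -> T `<=` T' -> T' b -> T' c) -> T c.
Proof.
move=> thT hab hac hbc; apply: thT.2 hab.
apply: thT.2 (theory_imp_intro thT hbc); apply: thT.2 (theory_imp_intro thT hac).
exact: theory_ax (ax_or_e _ _ _).
Qed.

Lemma theory_bot_elim T a : theory T -> T ⊥ -> T a.
Proof. by move=> thT; apply: thT.2; exact: theory_ax (ax_bot _). Qed.

Lemma theory_curry T a b c : theory T -> T (a ⋀ b ⟶ c) -> T (a ⟶ b ⟶ c).
Proof.
move=> thT habc; apply: (theory_imp_intro thT) => T1 th1 sub1 ha.
apply: (theory_imp_intro th1) => T2 th2 sub2 hb.
by apply: th2.2 (sub2 _ (sub1 _ habc)) _; apply: theory_and_intro (sub2 _ ha) hb.
Qed.

Lemma theory_imp_or T a b c : theory T ->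
  T (a ⋁ b ⟶ c) -> T (a ⟶ c) /\ T (b ⟶ c).
Proof.
move=> thT habc; split; apply: (theory_imp_intro thT) => T1 th1 sub1 h.
- by apply: th1.2 (sub1 _ habc) _; apply: theory_or_introl.
- by apply: th1.2 (sub1 _ habc) _; apply: theory_or_intror.
Qed.

(** Once [b ⟶ c] replaces the nested implication, the search for a proof of [a ⟶ b] has smaller
    hypotheses and terminates. *)
Lemma theory_imp_imp T a b c : theory T -> T ((a ⟶ b) ⟶ c) -> T (b ⟶ c).
Proof.
move=> thT habc; apply: (theory_imp_intro thT) => T1 th1 sub1 hb.
by apply: th1.2 (sub1 _ habc) _; apply: th1.2 hb; exact: theory_ax (ax_K _ _).
Qed.

End Theories.

(* Dyckhoff's contraction-free sequent calculus LJT: the antecedent consists of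
   the hypotheses [T _], the succedent is the goal. *)
Ltac intro_extension T :=
  let T' := fresh "T" in let thT' := fresh "thT" in
  let sub := fresh "sub" in let h := fresh "h" in
  intros T' thT' sub h;
  repeat match goal with H : T _ |- _ => apply sub in H end;
  clear dependent T.

Ltac ipc_invertible :=
  match goal with thT : theory ?T |- _ =>
  let h := fresh "h" in
  match goal with
  | H : T ?a |- T ?a => exact H
  | H : T ⊥ |- T ?a => exact (theory_bot_elim a thT H)
  | |- T (_ ⟶ _) => apply: (theory_imp_intro thT); intro_extension T
  | |- T (_ ⋀ _) => apply: (theory_and_intro thT)
  | H : T (_ ⋀ _) |- _ => destruct (theory_and_elim thT H) as [h ?]; clear H
  | H : T (?a ⟶ _), H' : T ?a |- _ => pose proof (thT.2 _ _ H H') as h; clear H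
  | H : T (⊥ ⟶ _) |- _ => clear H
  | H : T (_ ⋀ _ ⟶ _) |- _ => apply (theory_curry thT) in H
  | H : T (_ ⋁ _ ⟶ _) |- _ => destruct (theory_imp_or thT H) as [h ?]; clear H
  | H : T (_ ⋁ _) |- _ =>
      apply: (theory_or_elim thT H); clear H; intro_extension T
  end end.

Ltac ipc :=
  repeat ipc_invertible;
  match goal with thT : theory ?T |- _ =>
  match goal with
  | |- T (_ ⋁ _) => apply: (theory_or_introl _ thT); solve [ipc]
  | |- T (_ ⋁ _) => apply: (theory_or_intror _ thT); solve [ipc]
  | H : T ((?a ⟶ ?b) ⟶ ?c) |- _ =>
      let h := fresh "h" in let h' := fresh "h" in
      assert (h : T (a ⟶ b));
      [ pose proof (theory_imp_imp thT H) as h'; clear H; solve [ipc]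
      | pose proof (thT.2 _ _ H h) as h'; clear H h; solve [ipc] ]
  end end.

(** * Univariate formulas in the three-element chain *)

Section Chain.
Variable AP : Type.
Implicit Types (q : AP) (phi psi chi theta : formula AP) (T L : set (formula AP)).

(* The three-element chain appears as the persistent pairs [v.1 ==> v.2] of truth
   values at the root and at the top of the two-world Kripke model. *)
Fixpoint eval (v : bool * bool) phi : bool * bool :=
  match phi with
  | Atom _ => v
  | Bot => (false, false)
  | And a b => ((eval v a).1 && (eval v b).1, (eval v a).2 && (eval v b).2)
  | Or a b => ((eval v a).1 || (eval v b).1, (eval v a).2 || (eval v b).2)
  | Imp a b => (((eval v a).1 ==> (eval v b).1) && ((eval v a).2 ==> (eval v b).2),
                (eval v a).2 ==> (eval v b).2)
  end.

Lemma eval_persistent v phi : v.1 ==> v.2 -> (eval v phi).1 ==> (eval v phi).2.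
Proof.
move=> hv; elim: phi => //= a; case: (eval v a) => a1 a2 iha b;
  by case: (eval v b) a1 a2 iha => [[] []] [] [].
Qed.

(** The pairs [(b, b)] form the two-element Boolean subalgebra of the chain. *)
Lemma eval_classical (b : bool) phi : (eval (b, b) phi).1 = (eval (b, b) phi).2.
Proof.
elim: phi => //= a; case: (eval _ a) => a1 a2 /= -> c;
  by case: (eval _ c) => c1 c2 /= ->; case: a2 c2 => [] [].
Qed.

Definition of_value (v : bool * bool) psi : formula AP :=
  if v.1 then ⊤ else if v.2 then psi else ⊥.

Lemma apply_negated T chi psi : theory T -> T (∼psi) ->
  T (apply chi psi ⟷ of_value (eval (false, false) chi) psi).
Proof.
move=> thT hpsi; rewrite /apply.
elim: chi => [x||a iha b ihb|a iha b ihb|a iha b ihb] /=; rewrite /of_value /=;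
  try by ipc.
(* The middle value has to be excluded: its negation in the chain is the bottom, whereas [∼psi]
   makes [psi ⟶ ⊥] equivalent to ⊤. *)
all: move: iha ihb (eval_classical false a)
       (eval_classical false b).
all: case: (eval _ a) => [[] []]; case: (eval _ b) => [[] []] //.
all: rewrite /of_value /=; move=> iha ihb _ _; ipc.
Qed.

Lemma apply_dense T chi psi : theory T -> T (∼∼psi) ->
  T (apply chi psi ⟷ of_value (eval (false, true) chi) psi).
Proof.
move=> thT hpsi; rewrite /apply.
elim: chi => [x||a iha b ihb|a iha b ihb|a iha b ihb] /=; rewrite /of_value /=;
  try by ipc.
all: move: iha ihb (@eval_persistent (false, true) a isT)
       (@eval_persistent (false, true) b isT).
all: case: (eval _ a) => [[] []]; case: (eval _ b) => [[] []] //.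
all: rewrite /of_value /=; move=> iha ihb _ _; ipc.
Qed.

(** * Reduction of the fixed-point axiom *)

Definition fixpoint chi psi : formula AP := (apply chi (apply chi psi) ⟷ psi).

(** The first four branches belong to ⊥, [p], [p ⋁ ∼p] and ⊤, in this order; [∼p] and [∼∼p] share
    the last one, since both yield [∼∼p] when applied twice. *)
Definition reduced_fixpoint chi psi : formula AP :=
  match (eval (false, false) chi).1, eval (false, true) chi with
  | false, (false, false) => ∼psi
  | false, (false, true) => ⊤
  | true, (false, true) => ∼∼psi
  | true, (true, _) => psi
  | _, _ => ∼∼psi ⟶ psi
  end.

Lemma reduced_fixpointP T chi psi : theory T ->
  T (fixpoint chi psi) <-> T (reduced_fixpoint chi psi).
Proof.
move=> thT.
have neg z : T (∼z ⟶ (apply chi z ⟷ of_value (eval (false, false) chi) z)).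
  by apply: (theory_imp_intro thT) => T' thT' _; apply: apply_negated.
have dense z : T (∼∼z ⟶ (apply chi z ⟷ of_value (eval (false, true) chi) z)).
  by apply: (theory_imp_intro thT) => T' thT' _; apply: apply_dense.
(* [T] need not contain [∼z] or [∼∼z], so both evaluations enter as implications. These four
   instances suffice, with [chi(psi)] and [chi(chi(psi))] treated as atoms. *)
move: (neg psi) (neg (apply chi psi)) (dense psi) (dense (apply chi psi)).
rewrite /fixpoint /reduced_fixpoint; clear neg dense.
move: (eval_classical false chi) (@eval_persistent (false, true) chi isT).
move: (apply chi (apply chi psi)) (apply chi psi) => Y X.
case: (eval _ chi) => a _ /= <-; case: (eval _ chi) => [[] []] // _.
all: case: a; rewrite /of_value /= => n1 n2 d1 d2; split=> h; ipc.
Qed.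

Lemma theory_variant chi L : theory (variant chi L).
Proof. by split=> [phi|phi psi]; [apply: var_ipc | apply: var_mp]. Qed.

Lemma variant_le chi theta L :
  (forall q, reduced_fixpoint chi (Atom q) = reduced_fixpoint theta (Atom q)) ->
  variant chi L `<=` variant theta L.
Proof.
move=> eq_fix phi; elim=> {phi} [phi /var_ipc // | sigma phi /var_subst // | q |].
- have thT := theory_variant theta L; rewrite -/(fixpoint chi (Atom q)).
  apply/(reduced_fixpointP _ _ thT); rewrite eq_fix.
  by apply/(reduced_fixpointP _ _ thT); apply: var_fix.
- by move=> phi psi _ hphi _; apply: var_mp.
Qed.

Lemma same_lattice_reduced chi theta :
  (forall q, reduced_fixpoint chi (Atom q) = reduced_fixpoint theta (Atom q)) ->
  same_lattice chi theta.
Proof. by move=> eq_fix L _; apply/seteqP; split; apply: variant_le. Qed.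

(** * Separation of variants by values in the chain *)

Lemma IPC_subst : closed_subst (IPC (AP := AP)).
Proof.
move=> sigma phi; elim=> {phi} [phi [] *|phi psi _ h _]; last exact: th_mp.
all: by apply: th_ax; constructor.
Qed.

Lemma intermediate_IPC : intermediate (IPC (AP := AP)).
Proof.
split=> //; [|by move=> phi psi; apply: th_mp|exact: IPC_subst].
move=> phi; elim=> {phi} [phi hphi|phi psi _ h _]; last exact: th_mp.
by apply: th_ax; left.
Qed.

Lemma eval_mp v phi psi : (eval v (phi ⟶ psi)).1 -> (eval v phi).1 -> (eval v psi).1.
Proof. by move=> /= /andP[/implyP]. Qed.

Lemma IPC_sound v phi : v.1 ==> v.2 -> IPC phi -> (eval v phi).1.
Proof.
move=> hv; elim=> {phi} [phi ax|phi psi _ + _]; last exact: eval_mp.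
have pers x := eval_persistent x hv.
by case: ax => [a b|a b c|a b|a b|a b|a b|a b|a b c|a] /=;
  move: (pers a); try move: (pers b); try move: (pers c);
  case: (eval v a) => [[] []] //=;
  try case: (eval v b) => [[] []] //=; try case: (eval v c) => [[] []] //=.
Qed.

(** Substitution instances of theorems are theorems, so [v] only has to satisfy the fixed-point
    axioms. *)
Lemma variant_sound v chi phi : v.1 ==> v.2 ->
  (forall q, (eval v (fixpoint chi (Atom q))).1) ->
  variant chi (IPC (AP := AP)) phi -> (eval v phi).1.
Proof.
move=> hv sol; elim=> {phi} [phi|sigma phi|//|phi psi _ + _].
- exact: IPC_sound.
- by move=> /(IPC_subst sigma); apply: IPC_sound.
- exact: eval_mp.
Qed.

(** Equality is tested at [IPC]: a solution for [chi] validates its whole variant, hence also the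
    fixed-point axiom of [theta]. *)
Lemma same_lattice_solutions v q chi theta : v.1 ==> v.2 ->
  same_lattice chi theta ->
  (forall x, (eval v (fixpoint chi (Atom x))).1) ->
  (eval v (fixpoint theta (Atom q))).1.
Proof.
move=> hv /(_ _ intermediate_IPC) eq_var sol.
by apply: (variant_sound hv sol); rewrite eq_var; apply: var_fix.
Qed.

Lemma same_lattice_sym chi theta : same_lattice chi theta -> same_lattice theta chi.
Proof. by move=> h L /h. Qed.

Lemma variant_atom p L : intermediate L -> variant (Atom p) L = L.
Proof.
move=> [ipcL _ mpL substL]; apply/seteqP; split=> phi; last first.
  (* The identity substitution embeds [L]. *)
  move=> /(var_subst (Atom p) (@Atom AP)); congr variant.
  by elim: phi => //= a -> b ->.
elim=> {phi} [phi /ipcL //|sigma phi /substL //|q|phi psi _ + _]; last exact: mpL.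
have thL : theory L by [].
by apply/(reduced_fixpointP (Atom p) (Atom q) thL); apply: (theory_imp_intro thL).
Qed.

End Chain.

Theorem corollary36 (AP : Type) (AP_infinite : infinite_set [set: AP]) (p : AP) :
  let P := Atom p in
  let five := [:: ⊥; P; ∼P; P ⋁ ∼P; ⊤] in
  [/\ forall L : set (formula AP), intermediate L -> variant P L = L,
      same_lattice (∼P) (∼∼P),
      forall i j : nat, (i < j < 5)%N ->
        ~ same_lattice (nth ⊥ five i) (nth ⊥ five j) &
      forall chi : formula AP, univariate chi ->
        exists2 i : nat, (i < 5)%N & same_lattice chi (nth ⊥ five i)].
Proof.
move=> P five; split.
- by move=> L; apply: variant_atom.
- exact: same_lattice_reduced.
- move=> i j ij same.
  have sol v hv := same_lattice_solutions (v := v) p hv same.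
  have sol' v hv := same_lattice_solutions (v := v) p hv (same_lattice_sym same).
  (* With 0, m, 1 for the chain, the solution sets are, in order, {0}, {0, m, 1}, {0, 1}, {m, 1} and
     {1}. For each pair some value lies in just one set; [sol] and [sol'] cover the two
     directions. *)
  case: i j ij {same} sol sol' => [|[|[|[|[|i]]]]] [|[|[|[|[|j]]]]] //=;
    rewrite ?andbF // => _ sol sol';
    by [case: (notF (sol (false, false) isT (fun=> isT)))
       |case: (notF (sol (false, true) isT (fun=> isT)))
       |case: (notF (sol (true, true) isT (fun=> isT)))
       |case: (notF (sol' (false, false) isT (fun=> isT)))
       |case: (notF (sol' (false, true) isT (fun=> isT)))
       |case: (notF (sol' (true, true) isT (fun=> isT)))].
- move=> chi _.
  suff [i lti5 eq_fix] : exists2 i, (i < 5)%N & forall q,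
      reduced_fixpoint chi (Atom q) = reduced_fixpoint (nth ⊥ five i) (Atom q).
    by exists i => //; apply: same_lattice_reduced.
  rewrite {1}/reduced_fixpoint.
  (* The five formulas realize all five branches; the pair [(true, false)], which no formula attains
     here, falls into one of them too. *)
  case: (eval _ chi).1; case: (eval _ chi) => [[] []];
    by [exists 0 | exists 1 | exists 2 | exists 3 | exists 4].
Qed.
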